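(* Let $F:\mathbb{R}^d\to\mathbb{R}$ be convex and differentiable. Fix a point $x$, a descent direction $d$, a constant $c\in(0,1)$ and an initial step-size $\alpha_0>0$. Then the number of evaluations of the Armijo condition that backtracking line search (BLS) with factor $\rho$ makes in order to return a feasible step-size is nondecreasing in the input $\rho\in(0,1)$: if $0<\rho_1<\rho_2<1$, then BLS with factor $\rho_1$ makes no more evaluations than BLS with factor $\rho_2$.
   Context: A direction $d$ is a descent direction at $x$ if $\langle\nabla F(x),d\rangle<0$. The Armijo condition for a step-size $\alpha>0$ is $$F(x+\alpha d)-F(x)\le c\,\alpha\langle\nabla F(x),d\rangle;$$ a step-size satisfying it is called feasible. Backtracking line search (BLS) with inputs $\alpha_0>0$ and $\rho\in(0,1)$: set $\alpha\gets\alpha_0$; while the Armijo condition fails for $\alpha$, set $\alpha\gets\rho\alpha$; return $\alpha$. Each time the condition is tested counts as one evaluation. *)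

(* Defs.v *)
From mathcomp Require Import all_boot all_order all_algebra.
From mathcomp Require Import all_classical all_reals all_analysis.

Set Implicit Arguments.
Unset Strict Implicit.
Unset Printing Implicit Defensive.

Import Order.TTheory GRing.Theory Num.Theory.
Import numFieldNormedType.Exports.

Local Open Scope ring_scope.

Section BacktrackingLineSearch.
Context {R : realType} {n : nat}.
Implicit Types (F : 'rV[R]_n -> R^o) (x d u v : 'rV[R]_n).

Definition inner_prod u v : R := \sum_(i < n) u 0 i * v 0 i.

Definition gradient F x : 'rV[R]_n := \row_(i < n) 'D_(delta_mx 0 i) F x.

Definition descent_direction F x d : Prop := inner_prod (gradient F x) d < 0.

Definition armijo F x d (c alpha : R) : bool :=
  F (x + alpha *: d) - F x <= c * alpha * inner_prod (gradient F x) d.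

(* [bls_run F x d c rho alpha k beta]: the backtracking loop with factor [rho],
   entered with current step-size [alpha], terminates and returns [beta] after
   exactly [k] tests of the Armijo condition. The final, successful test is
   counted. A non-terminating execution has no derivation. *)
Inductive bls_run F x d (c rho : R) : R -> nat -> R -> Prop :=
| bls_return alpha :
    armijo F x d c alpha -> bls_run F x d c rho alpha 1 alpha
| bls_shrink alpha k beta :
    ~~ armijo F x d c alpha ->
    bls_run F x d c rho (rho * alpha) k beta ->
    bls_run F x d c rho alpha k.+1 beta.

(* A run is determined by its inputs, so "the number of evaluations" is
   well defined whenever the search terminates. *)
Lemma bls_run_functional F x d (c rho alpha : R) k1 beta1 k2 beta2 :
  bls_run F x d c rho alpha k1 beta1 ->
  bls_run F x d c rho alpha k2 beta2 -> k1 = k2 /\ beta1 = beta2.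
Proof.
move=> run1; elim: run1 k2 beta2 => {alpha k1 beta1}
  [alpha ok|alpha k1 beta1 /negP nok _ IH] k2 beta2 run2.
  by case: run2 ok => // a k b /negP.
by case: run2 nok IH => // a k b _ run2 _ IH; have [-> ->] := IH _ _ run2.
Qed.

End BacktrackingLineSearch.

(* Main.v *)
(** Convexity makes the feasible set downward closed: if [alpha] is feasible and
    [0 < beta <= alpha], then [x + beta d] lies between [x] and [x + alpha d], and
    the Armijo bound is affine in the step-size.  Hence if the [j]-th trial step
    [rho2 ^+ j * alpha0] is feasible, so is the smaller [rho1 ^+ j * alpha0].
    Termination holds because the slope of [F] along [d], which is the limit of
    the difference quotients, is strictly below [c] times itself. *)

Require Import Defs.
From mathcomp Require Import all_boot all_order all_algebra.
From mathcomp Require Import all_classical all_reals all_analysis.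
Import Order.TTheory GRing.Theory Num.Theory.
Import numFieldNormedType.Exports.
Local Open Scope ring_scope.

Section ArmijoFeasibility.
Set Implicit Arguments.
Unset Strict Implicit.
Context {R : realType} {n : nat}.
Implicit Types (F : 'rV[R]_n -> R^o) (x d : 'rV[R]_n).

(** The differential is linear, so expanding [d] in the canonical basis reduces it to partial
    derivatives. *)
Lemma derive_inner_prod F x d : differentiable F x ->
  'D_d F x = inner_prod (gradient F x) d.
Proof.
move=> dF; rewrite deriveE // [X in 'd F x X]row_sum_delta linear_sum /=.
by apply: eq_bigr => i _; rewrite linearZ /= mxE deriveE // mulrC.
Qed.

Lemma armijo_downward F x d (c alpha beta : R) :
  convex_function (E := 'rV[R]_n) [set: 'rV[R]_n]%classic F ->
  0 < beta -> beta <= alpha ->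
  armijo F x d c alpha -> armijo F x d c beta.
Proof.
move=> F_convex beta_gt0 le_beta_alpha; rewrite /armijo => ok.
have alpha_gt0 : 0 < alpha by exact: lt_le_trans le_beta_alpha.
have t_ge0 : 0 <= beta / alpha by rewrite divr_ge0 ?ltW.
have t_le1 : beta / alpha <= 1 by rewrite ler_pdivrMr // mul1r.
(* The weight [beta / alpha] on [x + alpha *: d] makes the convex combination with [x] equal to
   [x + beta *: d]. *)
have := F_convex (Itv01 t_ge0 t_le1) (x + alpha *: d) x
  (in_setT _) (in_setT _).
have -> : conv (Itv01 t_ge0 t_le1) (x + alpha *: d : convex_lmodType _) x =
    x + beta *: d.
  rewrite /conv /= /unstable.onem scalerDr addrAC -scalerDl subrKC.
  by rewrite scale1r scalerA divfK ?gt_eqF.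
rewrite convRE /= /unstable.onem => le_conv.
have -> : c * beta = beta / alpha * (c * alpha).
  by rewrite mulrCA divfK ?gt_eqF.
rewrite -mulrA; apply: le_trans (ler_wpM2l t_ge0 ok).
by rewrite lerBlDr (le_trans le_conv) // mulrBl mul1r mulrBr addrA addrAC.
Qed.

Lemma armijo_geometric F x d (c alpha rho : R) :
  differentiable F x -> descent_direction F x d -> c < 1 ->
  0 < alpha -> 0 < rho -> rho < 1 ->
  exists k, armijo F x d c (rho ^+ k * alpha).
Proof.
move=> dF descent c_lt1 alpha_gt0 rho_gt0 rho_lt1.
(* The sequential form of the right-hand limit lets the difference quotient be followed along the
   trial steps alone. *)
have /cvg_dnbhs_at_right/cvg_at_rightP quotient_cvg :=
  @diff_derivable _ _ _ _ _ d dF.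
have steps_gt0 k : 0 < rho ^+ k * alpha by rewrite mulr_gt0 ?exprn_gt0.
have steps_cvg : ((rho ^+ k * alpha) @[k --> \oo] --> 0)%classic.
  rewrite -[X in (_ --> X)%classic](mul0r alpha); apply: cvgMl.
  by apply: cvg_expr; rewrite gtr0_norm.
have slope_lt : 'D_d F x < c * 'D_d F x.
  by rewrite derive_inner_prod // ltr_nMl.
(* The quotients eventually drop below [c * 'D_d F x]; multiplying by the positive step gives the
   Armijo condition. *)
have /cvgr_lt/(_ _ slope_lt) := quotient_cvg _ (conj steps_gt0 steps_cvg).
move=> /(@filter_ex _ _ _) [k] /=; set h := rho ^+ k * alpha => lt_k.
exists k; rewrite /armijo -/h -derive_inner_prod // [x + _]addrC.
by rewrite [c * h]mulrC -mulrA -ler_pdivrMl ?steps_gt0 // ltW.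
Qed.

Lemma bls_run_terminates F x d (c rho alpha : R) k :
  armijo F x d c (rho ^+ k * alpha) ->
  exists j beta, bls_run F x d c rho alpha j beta.
Proof.
elim: k alpha => [|k IH] alpha; first by rewrite mul1r; exists 1%N, alpha; left.
rewrite exprSr -mulrA => /IH[j [beta run]].
have [ok|nok] := boolP (armijo F x d c alpha); first by exists 1%N, alpha; left.
by exists j.+1, beta; right.
Qed.

(** Trial steps are indexed from 0, so trial [j] is test [j.+1], and the loop cannot go past a
    feasible trial. *)
Lemma bls_run_leq F x d (c rho alpha beta : R) j k :
  bls_run F x d c rho alpha k beta ->
  armijo F x d c (rho ^+ j * alpha) -> (k <= j.+1)%N.
Proof.
move=> run; elim: run j => // {}alpha {}k {}beta nok _ IH [|j].
  by rewrite mul1r (negbTE nok).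
by rewrite exprSr -mulrA => /IH.
Qed.

(** The last of the [k] tests is the successful one, and it examines trial [k.-1]; positivity of [k]
    rules out the truncated predecessor of 0. *)
Lemma bls_run_feasible F x d (c rho alpha beta : R) k :
  bls_run F x d c rho alpha k beta ->
  (0 < k)%N /\ armijo F x d c (rho ^+ k.-1 * alpha).
Proof.
elim=> [{}alpha|{}alpha {}k {}beta _ _ [k_gt0 ok]]; first by rewrite mul1r.
by split=> //=; rewrite -(prednK k_gt0) exprSr -mulrA.
Qed.

End ArmijoFeasibility.

Theorem proposition4 (R : realType) (n : nat) (F : 'rV[R]_n -> R^o)
    (F_convex : convex_function (E := 'rV[R]_n) [set: 'rV[R]_n]%classic F)
    (F_diff : forall y : 'rV[R]_n, differentiable F y)
    (x d : 'rV[R]_n) (d_descent : descent_direction F x d)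
    (c : R) (c_gt0 : 0 < c) (c_lt1 : c < 1)
    (alpha0 : R) (alpha0_gt0 : 0 < alpha0) :
  (forall rho : R, 0 < rho -> rho < 1 ->
     exists (k : nat) (alpha : R), bls_run F x d c rho alpha0 k alpha) /\
  (forall rho1 rho2 : R, 0 < rho1 -> rho1 < rho2 -> rho2 < 1 ->
     forall (k1 k2 : nat) (alpha1 alpha2 : R),
       bls_run F x d c rho1 alpha0 k1 alpha1 ->
       bls_run F x d c rho2 alpha0 k2 alpha2 ->
       (k1 <= k2)%N).
Proof.
split=> [rho rho_gt0 rho_lt1|rho1 rho2 rho1_gt0 lt_rho _ k1 k2 beta1 beta2].
  have [k ok] :=
    armijo_geometric (F_diff x) d_descent c_lt1 alpha0_gt0 rho_gt0 rho_lt1.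
  exact: bls_run_terminates ok.
move=> run1 /bls_run_feasible[k2_gt0 ok2].
(* It remains to carry feasibility of trial [k2.-1] from [rho2] to the smaller step of [rho1]. *)
rewrite -(prednK k2_gt0); apply: bls_run_leq run1 _.
apply: armijo_downward ok2 => //; first by rewrite mulr_gt0 ?exprn_gt0.
by rewrite ler_wpM2r ?lerXn2r ?nnegrE ?ltW // (lt_trans rho1_gt0).
Qed.
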